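(* Let $q$ be a prime power, let $n,k,l,r$ be integers with $k\ge 1$, $l\ge 1$, $r\ge 0$ and $k+l+r=n$, and consider an $[n,k,l]$ partitioned linear block code over $F_q$ with minimum distances $(d_0,d_1)$. Let a message $\mathbf{w}\in F_q^k$ be encoded with the two-step encoding scheme, stored in $n$ independent cells of the $(\varepsilon,p)$ $q$-symmetric discrete memoryless memory cell (where $0\le\varepsilon\le 1$ and $0\le p\le 1$), with the defect vector known to the encoder, and decoded to $\widehat{\mathbf{w}}$ by minimum-weight syndrome decoding. Let $t_1=\lfloor (d_1-1)/2\rfloor$, and let $A_w$ be the number of codewords of Hamming weight $w$ in the linear block code $\{\mathbf{c}\in F_q^n : \mathbf{c}G_0^T=\mathbf{0}\}$ whose parity check matrix is $G_0$. Then the probability of decoding failure satisfies $$P(\widehat{\mathbf{w}}\neq\mathbf{w}) \le \sum_{u=d_0}^{n}\left\{\binom{n}{u}\varepsilon^u(1-\varepsilon)^{n-u}\cdot\frac{\sum_{w=d_0}^{u}A_w\binom{n-w}{u-w}}{\binom{n}{u}}\cdot\sum_{t=t_1+d_0-u}^{n-u}\binom{n-u}{t}p^t(1-p)^{n-u-t}\right\}$$ $$\qquad\qquad + \sum_{u=0}^{n}\left\{\binom{n}{u}\varepsilon^u(1-\varepsilon)^{n-u}\cdot\sum_{t=t_1+1}^{n-u}\binom{n-u}{t}p^t(1-p)^{n-u-t}\right\}.$$ Here $\binom{m}{t}=0$ for $t<0$ (terms with negative $t$ are omitted), and empty sums are $0$.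
   Context: Channel. $F_q$ is the field with $q$ elements, $\lambda$ is an extra symbol not in $F_q$, and $\widetilde{F}_q=F_q\cup\{\lambda\}$. For $x\in F_q$, $s\in\widetilde{F}_q$ define $x\circ s=x$ if $s=\lambda$ and $x\circ s=s$ if $s\ne\lambda$; for vectors, $\circ$ acts componentwise. An $n$-cell memory storing $\mathbf{x}\in F_q^n$ outputs $\mathbf{y}=(\mathbf{x}\circ\mathbf{s})+\mathbf{z}$, where $\mathbf{s}\in\widetilde{F}_q^n$ is the defect vector and $\mathbf{z}\in F_q^n$ is the random error vector. In the $(\varepsilon,p)$ $q$-symmetric discrete memoryless memory cell model, the pairs $(S_i,Z_i)$, $i=1,\dots,n$, are independent and identically distributed, and independent of the message, with $P(S=\lambda)=1-\varepsilon$ and $P(S=s)=\varepsilon/q$ for each $s\in F_q$; $P(Z=0\mid S=\lambda)=1-p$ and $P(Z=z\mid S=\lambda)=p/(q-1)$ for each $z\neq 0$; and $Z=0$ whenever $S\ne\lambda$. The number of defects $u$ is the number of non-$\lambda$ components of $\mathbf{s}$; $\|\cdot\|$ denotes Hamming weight. Code. An $[n,k,l]$ partitioned linear block code (PLBC) is a pair of linear subspaces $\mathcal{C}_1,\mathcal{C}_0\subset F_q^n$ of dimensions $k$ and $l$ with $\mathcal{C}_1\cap\mathcal{C}_0=\{\mathbf{0}\}$. $G_1$ ($k\times n$) and $G_0$ ($l\times n$) are generator matrices of $\mathcal{C}_1$ and $\mathcal{C}_0$. $H$ is an $r\times n$ parity check matrix of the $[n,k+l]$ linear code $\mathcal{C}_1+\mathcal{C}_0$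 (so $\mathcal{C}_1+\mathcal{C}_0=\{\mathbf{c}:\mathbf{c}H^T=\mathbf{0}\}$). $\widetilde{G}_1$ is a $k\times n$ matrix with $G_1\widetilde{G}_1^T=I_k$ and $G_0\widetilde{G}_1^T=0_{l,k}$. The minimum distances are $$d_0=\min\{\|\mathbf{c}\| : \mathbf{c}\ne\mathbf{0},\ \mathbf{c}G_0^T=\mathbf{0}\},\qquad d_1=\min\{\|\mathbf{c}\| : \mathbf{c}\widetilde{G}_1^T\ne\mathbf{0},\ \mathbf{c}H^T=\mathbf{0}\}.$$ Two-step encoding scheme. The encoder knows $\mathbf{w}$ and $\mathbf{s}$ and stores $\mathbf{c}=\mathbf{w}G_1+\mathbf{d}G_0$, where $\mathbf{d}\in F_q^l$ is chosen (as a function of $\mathbf{w}$ and $\mathbf{s}$) as follows. For a set $\Psi$ of coordinates, a superscript $\Psi$ denotes restriction to the coordinates (columns) in $\Psi$. Let $\Psi_u$ be the set of the $u$ defect locations. Step 1: if the linear system $\mathbf{d}G_0^{\Psi_u}=\mathbf{s}^{\Psi_u}-\mathbf{w}G_1^{\Psi_u}$ has a solution $\mathbf{d}$, use such a solution (then $\mathbf{c}\circ\mathbf{s}=\mathbf{c}$). Step 2: otherwise (in which case necessarily $u\ge d_0$), choose a set $\Psi_{d_0-1}$ of $d_0-1$ of the $u$ defect locations and use a solution $\mathbf{d}$ of $\mathbf{d}G_0^{\Psi_{d_0-1}}=\mathbf{s}^{\Psi_{d_0-1}}-\mathbf{w}G_1^{\Psi_{d_0-1}}$ (one always exists). Decoding.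 From $\mathbf{y}=(\mathbf{c}\circ\mathbf{s})+\mathbf{z}$ (without knowledge of $\mathbf{s}$), compute $\mathbf{v}=\mathbf{y}H^T$, choose $\widehat{\mathbf{z}}\in F_q^n$ of minimum Hamming weight subject to $\widehat{\mathbf{z}}H^T=\mathbf{v}$, set $\widehat{\mathbf{c}}=\mathbf{y}-\widehat{\mathbf{z}}$ and output $\widehat{\mathbf{w}}=\widehat{\mathbf{c}}\widetilde{G}_1^T$. *)

(* Defs.v *)
From HB Require Import structures.
From mathcomp Require Import all_boot all_order all_algebra.
From mathcomp Require Import all_classical all_reals all_analysis.

Set Implicit Arguments.
Unset Strict Implicit.
Unset Printing Implicit Defensive.

Import Order.TTheory GRing.Theory Num.Theory.

Local Open Scope classical_set_scope.
Local Open Scope ring_scope.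

(* F_q is an arbitrary [F : finFieldType], with q = #|F|.  The extended alphabet
   F_q u {lambda} is [option F], where [None] is lambda: a non-defective cell. *)

Section Code.
Variables (F : finFieldType) (n : nat).

Definition hweight (c : 'rV[F]_n) : nat := #|[set i | c 0 i != 0]|%SET.

Definition generator_matrix m (G : 'M[F]_(m, n)) (C : {vspace 'rV[F]_n}) : Prop :=
  row_free G /\ forall c : 'rV[F]_n, (c \in C) = (c <= G)%MS.

Definition parity_check_matrix r (H : 'M[F]_(r, n)) (C : {vspace 'rV[F]_n}) : Prop :=
  forall c : 'rV[F]_n, (c \in C) = (c *m H^T == 0).

Definition is_min_weight (X : {pred 'rV[F]_n}) (d : nat) : Prop :=
  (exists2 c, c \in X & hweight c = d) /\ (forall c, c \in X -> (d <= hweight c)%N).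

Definition is_d0 l (G0 : 'M[F]_(l, n)) (d0 : nat) : Prop :=
  is_min_weight [pred c | (c != 0) && (c *m G0^T == 0)] d0.

Definition is_d1 k r (Gt1 : 'M[F]_(k, n)) (H : 'M[F]_(r, n)) (d1 : nat) : Prop :=
  is_min_weight [pred c | (c *m Gt1^T != 0) && (c *m H^T == 0)] d1.

Definition weight_count l (G0 : 'M[F]_(l, n)) (w : nat) : nat :=
  #|[set c : 'rV[F]_n | (c *m G0^T == 0) && (hweight c == w)]|%SET.

End Code.

Section Memory.
Variables (F : finFieldType) (n : nat).

Definition cell_write (x : F) (s : option F) : F :=
  if s is Some a then a else x.

Definition mem_write (c : 'rV[F]_n) (s : 'rV[option F]_n) : 'rV[F]_n :=
  \row_i cell_write (c 0 i) (s 0 i).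

Definition mem_output (c : 'rV[F]_n) (s : 'rV[option F]_n) (z : 'rV[F]_n) : 'rV[F]_n :=
  mem_write c s + z.

Definition defects (s : 'rV[option F]_n) : {set 'I_n} :=
  [set i | s 0 i != None]%SET.

End Memory.

Section Scheme.
Variables (F : finFieldType) (n k l r : nat).
Variables (G1 : 'M[F]_(k, n)) (G0 : 'M[F]_(l, n)).
Variables (H : 'M[F]_(r, n)) (Gt1 : 'M[F]_(k, n)).

(* The system d G_0^Psi = s^Psi - w G_1^Psi, coordinate by coordinate.  It is
   used only for Psi included in [defects s], where every s_i is some [Some a]. *)
Definition masks (Psi : {set 'I_n}) (w : 'rV[F]_k) (s : 'rV[option F]_n)
    (d : 'rV[F]_l) : Prop :=
  forall i a, i \in Psi -> s 0 i = Some a ->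
    (d *m G0) 0 i = a - (w *m G1) 0 i.

(* [D w s] is the vector d selected by the encoder; which solution is taken, and
   which set Psi of d0 - 1 defects in the second step, is left arbitrary. *)
Definition two_step_encoding (d0 : nat)
    (D : 'rV[F]_k -> 'rV[option F]_n -> 'rV[F]_l) : Prop :=
  forall w s,
    ((exists d, masks (defects s) w s d) -> masks (defects s) w s (D w s)) /\
    (~ (exists d, masks (defects s) w s d) ->
     exists Psi : {set 'I_n},
       [/\ Psi \subset defects s, #|Psi| = (d0 - 1)%N & masks Psi w s (D w s)]).

Definition plbc_encode (D : 'rV[F]_k -> 'rV[option F]_n -> 'rV[F]_l)
    (w : 'rV[F]_k) (s : 'rV[option F]_n) : 'rV[F]_n :=
  w *m G1 + D w s *m G0.

(* [zhat v] is the error estimate for the syndrome v; ties are broken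
   arbitrarily, and only the syndromes of actual words are constrained. *)
Definition min_weight_estimate (zhat : 'rV[F]_r -> 'rV[F]_n) : Prop :=
  forall y : 'rV[F]_n, let v := y *m H^T in
    zhat v *m H^T = v /\
    (forall z : 'rV[F]_n, z *m H^T = v -> (hweight (zhat v) <= hweight z)%N).

Definition plbc_decode (zhat : 'rV[F]_r -> 'rV[F]_n) (y : 'rV[F]_n) : 'rV[F]_k :=
  (y - zhat (y *m H^T)) *m Gt1^T.

End Scheme.

Section Probability.
Context {R : realType} {d : measure_display} {Omega : measurableType d}.
Variable P : probability Omega R.

(* A random variable with values in a finite set carrying the discrete
   sigma-algebra. *)
Definition discrete_rv (T : finType) (X : Omega -> T) : Prop :=
  forall A : set T, measurable (X @^-1` A).

Definition independent_rvs (T U : finType) (X : Omega -> T) (Y : Omega -> U) : Prop :=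
  forall (A : set T) (B : set U),
    P (X @^-1` A `&` Y @^-1` B) = (P (X @^-1` A) * P (Y @^-1` B))%E.

(* Mutual independence: taking some of the [A i] equal to [setT] gives the
   product rule for every subfamily. *)
Definition mutually_independent_rvs n (T : finType) (X : 'I_n -> Omega -> T) : Prop :=
  forall A : 'I_n -> set T,
    P [set omega | forall i, A i (X i omega)] =
    (\prod_(i < n) fine (P (X i @^-1` A i)))%:E.

Definition has_pmf (T : finType) (X : Omega -> T) (f : T -> R) : Prop :=
  forall x, P (X @^-1` [set x]) = (f x)%:E.

End Probability.

Section Channel.
Context {R : realType} {F : finFieldType}.
Variables eps p : R.

Definition defect_pmf (s : option F) : R :=
  if s is Some _ then eps / #|F|%:R else 1 - eps.

Definition error_pmf (s : option F) (z : F) : R :=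
  match s with
  | None => if z == 0 then 1 - p else p / (#|F|%:R - 1)
  | Some _ => if z == 0 then 1 else 0
  end.

(* P(S = s, Z = z) = P(S = s) P(Z = z | S = s); the product form also makes
   sense when the conditioning event has probability 0. *)
Definition cell_pmf (x : option F * F) : R :=
  defect_pmf x.1 * error_pmf x.1 x.2.

(* S is the defect vector, Z the random error vector, W the stored message. *)
Definition symmetric_memory_model {d : measure_display} {Omega : measurableType d}
    (P : probability Omega R) n k (W : Omega -> 'rV[F]_k)
    (S : Omega -> 'rV[option F]_n) (Z : Omega -> 'rV[F]_n) : Prop :=
  let cell i omega := (S omega 0 i, Z omega 0 i) in
  [/\ discrete_rv W,
      forall i, discrete_rv (cell i),
      forall i, has_pmf P (cell i) cell_pmf,
      mutually_independent_rvs P cell &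
      independent_rvs P W (fun omega => (S omega, Z omega))].

End Channel.

(* Main.v *)
Require Import Defs.
From HB Require Import structures.
From mathcomp Require Import all_boot all_order all_algebra.
From mathcomp Require Import all_classical all_reals all_analysis.

(** Write [e = (c o s) - c] for the masking error.  The received word is
    [c + (e + z)], so decoding succeeds as soon as [e + z] has weight at most
    [t1].  If masking succeeds then [e = 0]; otherwise [e] vanishes on [d0 - 1]
    defects and the defect set [U] contains the support of a nonzero word of the
    dual code of [G0].  Hence a failure forces an event that depends only on the
    pair ([U], [supp z]), whatever the encoder and the message are.  The law of
    this pair is explicit, and the number of sets [U] of size [u] containing the
    support of a nonzero dual word is at most
    [\sum_w A_w 'C(n - w, u - w)] by the union bound. *)

Set Implicit Arguments.
Unset Strict Implicit.
Unset Printing Implicit Defensive.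

Import Order.TTheory GRing.Theory Num.Theory.

Local Open Scope ring_scope.

(** * Counting finite sets by cardinality *)

Section Counting.
Variable T : finType.
Implicit Types A B : {set T}.

(** Adjoining [B] is a bijection from the subsets of [~: B] of size [u - #|B|] onto these supersets;
    removing [B] inverts it. For [u < #|B|] the truncated subtraction would give 1 on the right and
    0 on the left. *)
Lemma card_supersets B (u : nat) : (#|B| <= u)%N ->
  #|[set A : {set T} | (B \subset A) && (#|A| == u)]%SET|
    = 'C(#|T| - #|B|, u - #|B|).
Proof.
move=> leBu; rewrite -(cardsC B) addnC addnK -cards_draws.
rewrite -[RHS](@card_in_imset _ _ (fun A => B :|: A)%SET); last first.
  move=> A A'; rewrite !inE => /andP[sA _] /andP[sA' _] eqU.
  have disjU (X : {set T}) : X \subset (~: B)%SET -> ((B :|: X) :\: B)%SET = X.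
    by move=> /finset.setIidPl sX; rewrite finset.setDE finset.setIUl finset.setICr finset.set0U.
  by rewrite -(disjU A) // eqU disjU.
apply: eq_card => A; rewrite !inE; apply/andP/imsetP => [[sBA /eqP cA]|[X]].
  exists (A :\: B)%SET; last by rewrite -{1}(finset.setIidPr sBA) finset.setID.
  by rewrite inE finset.setDE finset.subsetIr -finset.setDE cardsD (finset.setIidPr sBA) cA eqxx.
rewrite inE => /andP[sX /eqP cX] ->; split; first exact: finset.subsetUl.
rewrite cardsU cX (_ : (B :&: X)%SET = finset.set0) ?cards0 ?subn0 ?subnKC //.
by apply/eqP; rewrite finset.setI_eq0 disjoint_sym finset.disjoints_subset.
Qed.

(** Groups the sets by size. The bound [m] makes the sizes fit in ['I_m.+1], so that [inord]
    preserves them. *)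
Lemma sum_card_ge (R : nmodType) (Q : {pred {set T}}) (g : nat -> R) a m :
  (forall A, Q A -> (#|A| <= m)%N) ->
  \sum_(A : {set T} | Q A && (a <= #|A|)%N) g #|A|
    = \sum_(a <= t < m.+1) g t *+ #|[set A : {set T} | Q A && (#|A| == t)]%SET|.
Proof.
move=> Qm.
rewrite big_geq_mkord (partition_big (fun A : {set T} => inord #|A| : 'I_m.+1)
  (fun t : 'I_m.+1 => a <= t)%N) /=; last first.
  by move=> A /andP[/Qm QA aA]; rewrite inordK.
apply: eq_bigr => t at_; rewrite -sumr_const.
apply: eq_big => [A|A].
  rewrite inE; case QA: (Q A) => //=.
  have := Qm A QA => cA; rewrite -val_eqE /= inordK //.
  by case: eqP => [->|]; rewrite ?at_ ?andbT ?andbF.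
by case/andP=> /andP[/Qm QA _] /eqP <-; rewrite inordK.
Qed.

End Counting.

(** * Minimum-weight decoding and obstructions to masking *)

Section Coding.
Variables (F : finFieldType) (n : nat).
Implicit Types c z : 'rV[F]_n.

Definition hsupport c : {set 'I_n} := [set i | c 0 i != 0]%SET.

Lemma hweightD c z : (hweight (c + z)%R <= hweight c + hweight z)%N.
Proof.
apply: leq_trans (leq_card_setU _ _); apply: subset_leq_card.
apply/fintype.subsetP => i; rewrite !inE mxE; apply: contraR.
by rewrite negb_or !negbK => /andP[/eqP-> /eqP->]; rewrite addr0.
Qed.

Lemma hweightN c : hweight (- c) = hweight c.
Proof. by apply: eq_card => i; rewrite !inE mxE oppr_eq0. Qed.

Lemma hweight_gt0 c : (0 < hweight c)%N = (c != 0).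
Proof.
apply/card_gt0P/idP => [[i]|/rV0Pn[i ci]]; last by exists i; rewrite inE.
by rewrite inE => ci; apply/rV0Pn; exists i.
Qed.

(** The estimate [e] may differ from [z], but [z - e] has zero syndrome and weight at most twice
    [(d1 - 1) %/ 2], hence below [d1]. By minimality of [d1] it is killed by [Gt1^T], so the message
    is unaffected. *)
Lemma plbc_decode_correct k r (H : 'M[F]_(r, n)) (Gt1 : 'M[F]_(k, n))
    (zhat : 'rV[F]_r -> 'rV[F]_n) d1 c z :
  is_d1 Gt1 H d1 -> min_weight_estimate H zhat -> c *m H^T = 0 ->
  (hweight z <= (d1 - 1) %/ 2)%N ->
  plbc_decode H Gt1 zhat (c + z) = c *m Gt1^T.
Proof.
move=> [[c1 /andP[c1N _] c1w] d1min] zhatP cH hz.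
(* Positivity rules out truncation in [d1 - 1], which the final strict inequality relies on. *)
have d1_gt0 : (0 < d1)%N.
  by rewrite -c1w hweight_gt0; apply: contraNneq c1N => ->; rewrite mul0mx.
have [zhatH zhatw] := zhatP (c + z).
rewrite /plbc_decode; set e := zhat _ in zhatH zhatw *.
have ezH : (z - e) *m H^T = 0.
  by rewrite mulmxBl zhatH mulmxDl cH add0r subrr.
rewrite -addrA mulmxDl; suff /eqP-> : (z - e) *m Gt1^T == 0 by rewrite addr0.
apply: contraT => ezG; have := d1min (z - e).
rewrite inE ezG ezH eqxx => /(_ isT) d1le.
have := leq_trans d1le (hweightD z (- e)); rewrite hweightN.
have := zhatw z; rewrite mulmxDl cH add0r => /(_ erefl) lez.
move=> /leq_trans/(_ (leq_add hz (leq_trans lez hz))).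
by rewrite addnn -muln2 leqNgt; rewrite (leq_ltn_trans (leq_divM _ _)) // subn1 prednK.
Qed.

(** Equivalently, the columns of [G0] indexed by [U] are linearly dependent, [c] being the vector of
    coefficients. *)
Definition masking_obstruction l (G0 : 'M[F]_(l, n)) (U : {set 'I_n}) : bool :=
  [exists c : 'rV[F]_n, [&& c != 0, c *m G0^T == 0 & hsupport c \subset U]].

(* Without an obstruction, the coordinate projection onto [U] has the same row
   space after multiplication by [G0] on the left: the columns of its product
   with a cokernel matrix are words of the dual code supported in [U]. *)
Lemma masks_solvable k l (G1 : 'M[F]_(k, n)) (G0 : 'M[F]_(l, n)) w s :
  ~~ masking_obstruction G0 (defects s) ->
  exists d, masks G1 G0 (defects s) w s d.
Proof.
move=> nobs; set U := defects s in nobs *.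
pose E : 'M[F]_n := diag_mx (\row_i (i \in U)%:R).
have sE : (E <= G0 *m E)%MS.
  rewrite submxE; apply/eqP/matrixP => i j; rewrite [RHS]mxE.
  pose x := row j (E *m cokermx (G0 *m E))^T.
  have xE m : x 0 m = (E *m cokermx (G0 *m E)) m j by rewrite !mxE.
  rewrite -xE; suff -> : x = 0 by rewrite mxE.
  apply/eqP; apply: contraNT nobs => x0; apply/existsP; exists x; rewrite x0 /=.
  apply/andP; split.
    rewrite /x -row_mul -trmx_mul mulmxA mulmx_coker trmx0.
    by apply/eqP/rowP=> m; rewrite !mxE.
  apply/fintype.subsetP => m; rewrite inE xE; apply: contraR => mU.
  by rewrite mul_diag_mx mxE mxE (negPf mU) mul0r.
(* The default 0 at non-defective cells is harmless: [E] erases those coordinates. *)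
pose b : 'rV[F]_n := \row_i (cell_write 0 (s 0 i) - (w *m G1) 0 i).
have /submxP[d bd] : (b *m E <= G0 *m E)%MS by apply: submx_trans (submxMl _ _) sE.
exists d => i a iU sia; have /rowP/(_ i) := bd.
by rewrite mulmxA !mul_mx_diag !mxE iU !mulr1 sia /= => <-.
Qed.

Lemma card_masking_obstruction l (G0 : 'M[F]_(l, n)) d0 (u : nat) : is_d0 G0 d0 ->
  (#|[set U : {set 'I_n} | masking_obstruction G0 U && (#|U| == u)]%SET|
   <= \sum_(d0 <= w < u.+1) weight_count G0 w * 'C(n - w, u - w))%N.
Proof.
move=> [[c0 /andP[c0N _] c0w] d0min].
have d0_gt0 : (0 < d0)%N by rewrite -c0w hweight_gt0.
pose Sup c := [set U : {set 'I_n} | (hsupport c \subset U) && (#|U| == u)]%SET.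
(* Every nonzero dual word whose support lies in a set of size [u] belongs to [X]. The upper bound
   on the weight is what [card_supersets] requires. *)
pose X := [set c : 'rV[F]_n | [&& c *m G0^T == 0, (d0 <= hweight c)%N & (hweight c <= u)%N]]%SET.
apply: (@leq_trans (\sum_(c in X) #|Sup c|)%N).
  apply: (@leq_trans #|(\bigcup_(c in X) Sup c)%SET|); last first.
    elim/big_rec2: _ => [|c m A _ le]; first by rewrite cards0.
    by rewrite (leq_trans (leq_card_setU _ _)) // leq_add2l.
  apply: subset_leq_card; apply/fintype.subsetP => U; rewrite inE => /andP[].
  case/existsP => c /and3P[cN cG sc] cU; apply/finset.bigcupP; exists c; last by rewrite inE sc.
  rewrite inE cG d0min /=; last by rewrite inE cN.
  by rewrite -(eqP cU); apply: subset_leq_card.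
rewrite (eq_bigr (fun c => 'C(n - hweight c, u - hweight c))); last first.
  move=> c; rewrite inE => /and3P[_ _ cu].
  by rewrite /Sup card_supersets // card_ord.
rewrite big_geq_mkord (partition_big (fun c : 'rV[F]_n => inord (hweight c) : 'I_u.+1)
  (fun t : 'I_u.+1 => d0 <= t)%N) /=; last first.
  by move=> c; rewrite inE => /and3P[_ c0' cu]; rewrite inordK.
apply: leq_sum => w d0w; rewrite /weight_count -sum_nat_const.
rewrite [leqLHS](eq_bigr (fun=> 'C(n - w, u - w))); last first.
  move=> c /andP[]; rewrite inE => /and3P[_ _ cu] /eqP <-.
  by rewrite inordK.
rewrite !sum_nat_const leq_mul2r; apply/orP; right; apply: subset_leq_card.
apply/fintype.subsetP => c /andP[]; rewrite !inE => /and3P[-> _ cu] /eqP <-.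
by rewrite inordK /=.
Qed.

End Coding.

(** * From a decoding failure to a pattern of defects and errors *)

Section DecodingFailure.
Variables (F : finFieldType) (n k l r : nat).
Variables (C1 C0 : {vspace 'rV[F]_n}).
Variables (G1 : 'M[F]_(k, n)) (G0 : 'M[F]_(l, n)).
Variables (H : 'M[F]_(r, n)) (Gt1 : 'M[F]_(k, n)).
Hypotheses (hG1 : generator_matrix G1 C1) (hG0 : generator_matrix G0 C0).
Hypothesis hH : parity_check_matrix H (C1 + C0)%VS.
Hypotheses (hGt1 : G1 *m Gt1^T = 1%:M) (hGt0 : G0 *m Gt1^T = 0).
Variables (D : 'rV[F]_k -> 'rV[option F]_n -> 'rV[F]_l).

Lemma plbc_encode_syndrome w s : plbc_encode G1 G0 D w s *m H^T = 0.
Proof.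
apply/eqP; rewrite -hH memv_add //; first by rewrite (proj2 hG1) submxMl.
by rewrite (proj2 hG0) submxMl.
Qed.

Lemma plbc_encode_message w s : plbc_encode G1 G0 D w s *m Gt1^T = w.
Proof. by rewrite mulmxDl -!mulmxA hGt1 hGt0 mulmx1 mulmx0 addr0. Qed.

(** On [Psi] the codeword already agrees with the stuck values, so only defects outside [Psi] alter
    it. Both encoding steps are covered: [Psi] is the whole defect set in the first and has size
    [d0 - 1] in the second. *)
Lemma hweight_masked_defects (Psi : {set 'I_n}) w s :
  Psi \subset defects s -> masks G1 G0 Psi w s (D w s) ->
  (hweight (mem_write (plbc_encode G1 G0 D w s) s - plbc_encode G1 G0 D w s)
   <= #|defects s| - #|Psi|)%N.
Proof.
move=> sPsi maskPsi; rewrite -(finset.setIidPr sPsi) -cardsD.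
apply: subset_leq_card; apply/fintype.subsetP => i; rewrite !inE !mxE.
case sia: (s 0 i) => [a|] /=; last by rewrite subrr eqxx.
rewrite andbT; apply: contra => iPsi.
by have := maskPsi i a iPsi sia; rewrite !mxE => ->; rewrite addrCA subrr addr0 subrr.
Qed.

(** The first threshold expresses that the [#|U| - (d0 - 1)] unmasked defects and the [#|V|] errors
    together exceed the correction radius. It truncates to 0 for large [U], which matches the
    omission of negative [t]. *)
Definition failure_pattern d0 d1 (U V : {set 'I_n}) : bool :=
  (masking_obstruction G0 U && ((d1 - 1) %/ 2 + d0 - #|U| <= #|V|)%N)
  || ((d1 - 1) %/ 2 + 1 <= #|V|)%N.

(** By contraposition: outside the pattern, masking error and noise together have weight within the
    decoding radius. An obstruction is necessary for masking to fail, so the pattern may be larger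
    than the failure event. *)
Lemma failure_patternP d0 d1 zhat w s z :
  is_d1 Gt1 H d1 -> min_weight_estimate H zhat -> two_step_encoding G1 G0 d0 D ->
  plbc_decode H Gt1 zhat (mem_output (plbc_encode G1 G0 D w s) s z) != w ->
  failure_pattern d0 d1 (defects s) (hsupport z).
Proof.
move=> hd1 hzhat hD; apply: contraR; rewrite negb_or -!ltnNge addn1 ltnS.
case/andP=> obs zt; set c := plbc_encode _ _ _ _ _.
pose e := mem_write c s - c.
suff ezt : (hweight (e + z) <= (d1 - 1) %/ 2)%N.
  rewrite (_ : mem_output c s z = c + (e + z)); last first.
    by rewrite addrA /mem_output /e (addrC c) subrK.
  rewrite (plbc_decode_correct hd1 hzhat (plbc_encode_syndrome w s) ezt).
  by rewrite plbc_encode_message.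
apply: leq_trans (hweightD _ _) _; have [hD1 hD2] := hD w s.
have [/hD1 m1|unsol] := pselect (exists d, masks G1 G0 (defects s) w s d).
  by have := hweight_masked_defects (subxx _) m1; rewrite subnn leqn0 => /eqP->.
have [Psi [sPsi cPsi mPsi]] := hD2 unsol.
have obsU : masking_obstruction G0 (defects s).
  by apply: contrapT => /negP nobs; apply: unsol; exact: masks_solvable.
move: obs; rewrite obsU /= -ltnNge => obs.
have := subset_leq_card sPsi; have := hweight_masked_defects sPsi mPsi.
rewrite -/c -/e cPsi -/(hweight z) => he hP.
(* In additive form the inequality is free of truncation. *)
have {}obs : (hweight z + #|defects s| < (d1 - 1) %/ 2 + d0)%N by rewrite addnC -ltn_subRL.
apply: leq_trans (leq_add he (leqnn _)) _.
rewrite addnC addnBA // leq_subLR [leqRHS]addnC.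
(* For [d0 = 0] the term [d0 - 1] truncates to 0; otherwise the strict inequality pays for the
   subtracted 1. *)
case: (d0) obs => [|m]; first by rewrite sub0n !addn0 => /ltnW.
by rewrite subSS subn0 addnS ltnS.
Qed.

End DecodingFailure.

(** * Discrete random variables with finitely many values *)

Section FiniteRandomVariables.
Local Open Scope classical_set_scope.
Context {R : realType} {d : measure_display} {Omega : measurableType d}.
Variable P : probability Omega R.

Lemma discrete_rv_fibers (T : finType) (X : Omega -> T) :
  (forall x, measurable (X @^-1` [set x])) -> discrete_rv X.
Proof.
move=> mX A; rewrite (_ : X @^-1` A = \bigcup_(x in A) X @^-1` [set x]).
  by apply: fin_bigcup_measurable => //; exact: finite_finset.
by apply/seteqP; split => [om AX|om [x Ax] /= ->] //; exists (X om).
Qed.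

Lemma discrete_rv_comp (T U : finType) (f : T -> U) (X : Omega -> T) :
  discrete_rv X -> discrete_rv (f \o X).
Proof. by move=> mX A; rewrite comp_preimage; exact: mX. Qed.

Lemma discrete_rv_pair (T U : finType) (X : Omega -> T) (Y : Omega -> U) :
  discrete_rv X -> discrete_rv Y -> discrete_rv (fun om => (X om, Y om)).
Proof.
move=> mX mY; apply: discrete_rv_fibers => -[x y].
rewrite (_ : _ @^-1` _ = X @^-1` [set x] `&` Y @^-1` [set y]); first exact: measurableI.
by apply/seteqP; split => om [/= -> ->].
Qed.

Lemma discrete_rv_ffun (I T : finType) (X : I -> Omega -> T) :
  (forall i, discrete_rv (X i)) -> discrete_rv (fun om => [ffun i => X i om]).
Proof.
move=> mX; apply: discrete_rv_fibers => f.
rewrite (_ : _ @^-1` _ = \bigcap_(i in setT) X i @^-1` [set f i]).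
  by apply: fin_bigcap_measurable => [|i _]; [exact: finite_finset|exact: mX].
apply/seteqP; split => [om /= <- i _|om Xf] /=; first by rewrite ffunE.
by apply/ffunP => i; rewrite ffunE; exact: Xf.
Qed.

Lemma probability_preimage (T : finType) (X : Omega -> T) (Q : {pred T}) :
  discrete_rv X ->
  (P (X @^-1` [set` Q]) = \sum_(x in Q) P (X @^-1` [set x]))%E.
Proof.
move=> mX; rewrite -big_enum /= (fsbig_seq _ _ (enum_uniq Q)).
rewrite -measure_fin_bigcup //; first congr (P _).
- apply/seteqP; split => [om QX|om [x /= + ->]]; last by rewrite mem_enum.
  by exists (X om); rewrite //= mem_enum.
- by move=> x y _ _ [om [/= -> ->]].
Qed.

(** [E] need not be determined by [X]: being contained in the preimage of [Q] suffices, and that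
    preimage is a finite disjoint union of fibers. *)
Lemma probability_le_fibers (T : finType) (X : Omega -> T) (Q : {pred T}) (E : set Omega) :
  discrete_rv X -> measurable E -> (forall om, E om -> X om \in Q) ->
  (P E <= \sum_(x in Q) P (X @^-1` [set x]))%E.
Proof.
by move=> mX mE EQ; rewrite -probability_preimage //; apply: le_measure; rewrite ?inE.
Qed.

End FiniteRandomVariables.

(** * Law of the defect and error status of cells *)

Section Pattern.
Context {R : realType} {F : finFieldType}.
Variables eps p : R.

(** [a] stands for a defective cell and [b] for a nonzero error; the value 0 reflects that defective
    cells carry no random error. *)
Definition cell_status_prob (a b : bool) : R :=
  if a then (if b then 0 else eps) else (1 - eps) * (if b then p else 1 - p).

Lemma sum_error_pmf (s : option F) (b : bool) :
  \sum_(z : F | (z != 0) == b) error_pmf p s z =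
    if s is Some _ then (~~ b)%:R else if b then p else 1 - p.
Proof.
case: b; last first.
  rewrite (eq_bigl (pred1 0)) ?big_pred1_eq; last by move=> z /=; case: (z == 0).
  by case: s => [a|] /=; rewrite eqxx.
rewrite (eq_bigl (predC1 0)); last by move=> z /=; case: (z == 0).
rewrite (eq_bigr (fun=> if s is Some _ then 0 else p / (#|F|%:R - 1))); last first.
  by move=> z /negPf /= z0; case: s => [a|] /=; rewrite z0.
rewrite sumr_const cardC1; case: s => [a|]; first by rewrite mul0rn.
(* The denominator becomes the number of nonzero symbols, which cancels because a field has more
   than one element. *)
suff -> : p / (#|F|%:R - 1) = p / #|F|.-1%:R.
  rewrite -[LHS]mulr_natr divfK //.
  by rewrite pnatr_eq0 -lt0n -subn1 subn_gt0; exact: card_finNzRing_gt1.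
by rewrite -subn1 natrB // ltnW // card_finNzRing_gt1.
Qed.

Lemma sum_cell_pmf (a b : bool) :
  \sum_(x : option F * F | ((x.1 != None) == a) && ((x.2 != 0) == b)) cell_pmf eps p x
    = cell_status_prob a b.
Proof.
rewrite -(pair_big (fun s : option F => (s != None) == a) (fun z : F => (z != 0) == b)
  (fun s z => defect_pmf eps s * error_pmf p s z)) /=.
under eq_bigr => s _ do rewrite -mulr_sumr sum_error_pmf.
case: a => /=; last first.
  rewrite (eq_bigl (pred1 None)) ?big_pred1_eq; last by case.
  by [].
rewrite (eq_bigl (predC1 None)); last by case.
rewrite (eq_bigr (fun=> eps / #|F|%:R * (~~ b)%:R)); last by case.
rewrite sumr_const cardC1 card_option /= -[LHS]mulr_natr mulrAC divfK.
  by case: b; rewrite ?mulr0 ?mulr1.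
by rewrite pnatr_eq0 -lt0n; apply: ltnW; exact: card_finNzRing_gt1.
Qed.

(** A cell in both [U] and [V] contributes a zero factor. Otherwise the cells split into defects,
    erroneous cells and clean cells, each class with a constant factor. *)
Lemma prod_cell_status_prob n (U V : {set 'I_n}) :
  \prod_(i < n) cell_status_prob (i \in U) (i \in V) =
    if V \subset (~: U)%SET then
      eps ^+ #|U| * (1 - eps) ^+ (n - #|U|) * (p ^+ #|V| * (1 - p) ^+ (n - #|U| - #|V|))
    else 0.
Proof.
case: ifPn => [sV|/fintype.subsetPn[i iV]]; last first.
  by rewrite inE negbK => iU; rewrite (bigD1 i) //= iU iV mul0r.
have cU : (n - #|U|)%N = #|(~: U)%SET| by rewrite [RHS]cardsCs card_ord finset.setCK.
rewrite (bigID (mem U)) /= -mulrA; congr (_ * _).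
  rewrite (eq_bigr (fun=> eps)) ?prodr_const // => i iU; rewrite iU /=.
  by case: ifP => // /(fintype.subsetP sV); rewrite inE iU.
rewrite (eq_bigl (mem (~: U)%SET)); last by move=> i; rewrite /= inE.
rewrite (eq_bigr (fun i => (1 - eps) * (if i \in V then p else 1 - p))); last first.
  by move=> i; rewrite /= inE => /negPf ->.
rewrite big_split /= prodr_const cU; congr (_ * _).
rewrite (bigID (mem V)) /=; congr (_ * _).
  rewrite (eq_bigl (mem V)); last first.
    by move=> i /=; rewrite andbC; case: (boolP (i \in V)) => // /(fintype.subsetP sV).
  by rewrite (eq_bigr (fun=> p)) ?prodr_const // => i iV; rewrite (iV : i \in V).
rewrite (eq_bigl (mem ((~: U) :\: V)%SET)); last by move=> i; rewrite /= !inE andbC.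
rewrite (eq_bigr (fun=> 1 - p)) ?prodr_const ?cardsD ?(finset.setIidPr sV) // => i.
by rewrite /= inE => /andP[/negPf ->].
Qed.

Lemma cell_status_prob_ge0 a b : 0 <= eps <= 1 -> 0 <= p <= 1 ->
  0 <= cell_status_prob a b.
Proof.
move=> /andP[e0 e1] /andP[p0 p1]; rewrite /cell_status_prob.
by case: a; case: b; rewrite // mulr_ge0 ?subr_ge0.
Qed.

End Pattern.

(** * Law of the pair formed by the defect set and the error support *)

Section ChannelPatterns.
Local Open Scope classical_set_scope.
Context {R : realType} {F : finFieldType} {d : measure_display} {Omega : measurableType d}.
Variables (P : probability Omega R) (eps p : R) (n k : nat).
Variables (W : Omega -> 'rV[F]_k) (S : Omega -> 'rV[option F]_n) (Z : Omega -> 'rV[F]_n).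
Hypothesis hmodel : symmetric_memory_model eps p P W S Z.

(** The model gives measurability cell by cell; the vectors are recovered as a function of the
    finite family of cells. *)
Lemma discrete_rv_model : discrete_rv (fun om => (W om, (S om, Z om))).
Proof.
have [mW mcell _ _ _] := hmodel; apply: discrete_rv_pair => //.
pose f (x : {ffun 'I_n -> option F * F}) : 'rV[option F]_n * 'rV[F]_n :=
  (\row_i (x i).1, \row_i (x i).2).
rewrite (_ : (fun om => _) = f \o (fun om => [ffun i => (S om 0 i, Z om 0 i)])).
  by apply: discrete_rv_comp; exact: discrete_rv_ffun.
apply/funext => om; rewrite /f /=; congr (_, _); apply/rowP => i;
  by rewrite mxE ffunE.
Qed.

Lemma probability_cell_status i (a b : bool) :
  (P ((fun om => (S om 0%R i, Z om 0%R i)) @^-1`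
        [set x | ((x.1 != None) == a) && ((x.2 != 0%R) == b)])
   = (cell_status_prob eps p a b)%:E)%E.
Proof.
have [_ mcell pcell _ _] := hmodel.
rewrite (probability_preimage P (fun x => ((x.1 != None) == a) && ((x.2 != 0%R) == b)) (mcell i)).
by rewrite (eq_bigr _ (fun x _ => pcell i x)) sumEFin sum_cell_pmf.
Qed.

(** Fixing both sets prescribes the status of each cell separately, so mutual independence factors
    the probability. *)
Lemma probability_pattern (U V : {set 'I_n}) :
  P ((fun om => (defects (S om), hsupport (Z om))) @^-1` [set (U, V)])
    = (\prod_(i < n) cell_status_prob eps p (i \in U) (i \in V))%:E.
Proof.
have [_ _ _ indep _] := hmodel.
pose A i : set (option F * F) :=
  [set x | ((x.1 != None) == (i \in U)) && ((x.2 != 0) == (i \in V))].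
rewrite (_ : _ @^-1` _ = [set om | forall i, A i (S om 0 i, Z om 0 i)]); last first.
  apply/seteqP; split => om /=.
    by rewrite /A => /pair_equal_spec[<- <-] i /=; rewrite !inE !eqxx.
  move=> h; congr (_, _); apply/setP => i; rewrite !inE;
    by have /andP[/eqP + /eqP +] := h i.
rewrite indep; congr (_%:E); apply: eq_bigr => i _.
by rewrite probability_cell_status.
Qed.

End ChannelPatterns.

(** * Summation over patterns *)

Section SumOverPatterns.
Variables (R : realType) (eps p : R) (n : nat).
Hypotheses (heps : 0 <= eps <= 1) (hp : 0 <= p <= 1).
Implicit Types U V : {set 'I_n}.

Let mu U V := \prod_(i < n) cell_status_prob eps p (i \in U) (i \in V).

Definition binomial_tail m a : R :=
  \sum_(a <= t < m.+1) 'C(m, t)%:R * p ^+ t * (1 - p) ^+ (m - t).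

Lemma binomial_tail_ge0 m a : 0 <= binomial_tail m a.
Proof.
have /andP[p0 p1] := hp.
by apply: sumr_ge0 => t _; rewrite !mulr_ge0 ?exprn_ge0 ?subr_ge0.
Qed.

(** Only sets [V] disjoint from [U] have nonzero mass, and ['C(n - #|U|, t)] of them have size
    [t]. *)
Lemma sum_pattern_errors U a :
  \sum_(V : {set 'I_n} | (a <= #|V|)%N) mu U V
    = eps ^+ #|U| * (1 - eps) ^+ (n - #|U|) * binomial_tail (n - #|U|) a.
Proof.
have cU : #|(~: U)%SET| = (n - #|U|)%N by rewrite [LHS]cardsCs card_ord finset.setCK.
pose g t := eps ^+ #|U| * (1 - eps) ^+ (n - #|U|)
  * (p ^+ t * (1 - p) ^+ (n - #|U| - t)).
transitivity (\sum_(V : {set 'I_n} | (V \subset ~: U)%SET && (a <= #|V|)%N) g #|V|).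
  rewrite [RHS]big_mkcondl; apply: eq_bigr => V _.
  by rewrite /mu prod_cell_status_prob.
rewrite (@sum_card_ge _ _ (fun V : {set 'I_n} => (V \subset ~: U)%SET) g a (n - #|U|)); last first.
  by move=> V sV; rewrite -cU subset_leq_card.
rewrite /binomial_tail mulr_sumr; apply: eq_bigr => t _.
by rewrite cards_draws cU /g -[LHS]mulr_natl mulrCA; congr (_ * _); rewrite mulrA.
Qed.

Lemma sum_defect_sets (h : nat -> R) :
  \sum_(U : {set 'I_n}) h #|U| = \sum_(0 <= u < n.+1) 'C(n, u)%:R * h u.
Proof.
have := @sum_card_ge _ _ xpredT h 0%N n => -> //; last first.
  by move=> U _; rewrite -[leqRHS]card_ord max_card.
apply: eq_bigr => u _; rewrite -[LHS]mulr_natl; congr (_ * _); congr (_%:R).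
by rewrite -[in RHS](card_ord n) -card_draws; apply: eq_card => U; rewrite !inE.
Qed.

(** An obstructed set contains the support of a nonzero dual word, hence has at least [d0] elements;
    this is why the sum over [u] starts there. *)
Lemma sum_obstructed_sets (F : finFieldType) l (G0 : 'M[F]_(l, n)) d0 (h : nat -> R) :
  is_d0 G0 d0 -> (forall u, 0 <= h u) ->
  \sum_(U : {set 'I_n} | masking_obstruction G0 U) h #|U|
    <= \sum_(d0 <= u < n.+1)
         (\sum_(d0 <= w < u.+1) (weight_count G0 w)%:R * 'C(n - w, u - w)%:R) * h u.
Proof.
move=> hd0 h0.
rewrite (eq_bigl (fun U : {set 'I_n} => masking_obstruction G0 U && (d0 <= #|U|)%N)); last first.
  move=> U; case: (boolP (masking_obstruction G0 U)) => //= /existsP[c /and3P[c0 cG sc]].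
  rewrite (leq_trans _ (subset_leq_card sc)) //.
  by apply: (proj2 hd0); rewrite inE c0.
rewrite (@sum_card_ge _ _ (masking_obstruction G0) h d0 n); last first.
  by move=> U _; rewrite -[leqRHS]card_ord max_card.
apply: ler_sum => u _; rewrite -[leLHS]mulr_natl ler_wpM2r //.
under [leRHS]eq_bigr do rewrite -natrM.
by rewrite -natr_sum ler_nat; exact: card_masking_obstruction.
Qed.

Lemma sum_failure_patterns (F : finFieldType) l (G0 : 'M[F]_(l, n)) d0 d1 :
  is_d0 G0 d0 ->
  \sum_(x : {set 'I_n} * {set 'I_n} | failure_pattern G0 d0 d1 x.1 x.2) mu x.1 x.2
  <= \sum_(d0 <= u < n.+1)
       ('C(n, u)%:R * eps ^+ u * (1 - eps) ^+ (n - u)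
        * ((\sum_(d0 <= w < u.+1) (weight_count G0 w)%:R * 'C(n - w, u - w)%:R)
           / 'C(n, u)%:R)
        * binomial_tail (n - u) ((d1 - 1) %/ 2 + d0 - u))
     + \sum_(0 <= u < n.+1)
         ('C(n, u)%:R * eps ^+ u * (1 - eps) ^+ (n - u)
          * binomial_tail (n - u) ((d1 - 1) %/ 2 + 1)).
Proof.
move=> hd0; have /andP[e0 e1] := heps.
have mu0 U V : 0 <= mu U V.
  by apply: prodr_ge0 => i _; exact: cell_status_prob_ge0.
set t1 := ((d1 - 1) %/ 2)%N.
pose g a u := eps ^+ u * (1 - eps) ^+ (n - u) * binomial_tail (n - u) a.
have g0 a u : 0 <= g a u.
  by rewrite !mulr_ge0 ?exprn_ge0 ?subr_ge0 ?binomial_tail_ge0.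
apply: (@le_trans _ _
  (\sum_(U : {set 'I_n} | masking_obstruction G0 U) g (t1 + d0 - #|U|)%N #|U|
   + \sum_(U : {set 'I_n}) g (t1 + 1)%N #|U|)).
  rewrite -(eq_bigr _ (fun U _ => sum_pattern_errors U (t1 + d0 - #|U|))).
  rewrite -(eq_bigr _ (fun U _ => sum_pattern_errors U (t1 + 1))).
  rewrite !pair_big_dep /= [leLHS]big_mkcond.
  rewrite [X in X + _]big_mkcond [X in _ + X]big_mkcond -big_split /=.
  apply: ler_sum => -[U V] _ /=; rewrite /failure_pattern -/t1.
  (* A pattern satisfying both disjuncts is counted twice on the right, which only increases a sum
     of nonnegative masses. *)
  case: (_ && _); case: leqP => _ //=; rewrite ?addr0 ?add0r //.
  by rewrite lerDl.
apply: lerD; last first.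
  rewrite (sum_defect_sets (g _)) le_eqVlt; apply/orP; left; apply/eqP.
  by apply: eq_bigr => u _; rewrite /g !mulrA.
apply: le_trans (sum_obstructed_sets (h := fun u => g (t1 + d0 - u)%N u) hd0 _) _ => //.
rewrite le_eqVlt; apply/orP; left; apply/eqP.
rewrite !big_nat; apply: eq_bigr => u /andP[_]; rewrite ltnS => un.
(* The stated bound multiplies and divides by this binomial, which is nonzero since [u <= n]. *)
have Cn0 : 'C(n, u)%:R != 0 :> R by rewrite pnatr_eq0 -lt0n bin_gt0.
rewrite /g; set X := \sum_(_ <= _ < _) _.
by rewrite -{1}[X](divfK Cn0) [in RHS](mulrC _ (X / _)) !mulrA.
Qed.

End SumOverPatterns.

(** * Probability of decoding failure *)

Local Open Scope classical_set_scope.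
Local Open Scope ring_scope.

Theorem mainTheorem1
  (R : realType) (F : finFieldType) (n k l r : nat)
  (hk : (1 <= k)%N) (hl : (1 <= l)%N) (hn : (k + l + r)%N = n)
  (C1 C0 : {vspace 'rV[F]_n})
  (hC1 : \dim C1 = k) (hC0 : \dim C0 = l) (hC : (C1 :&: C0 = 0)%VS)
  (G1 : 'M[F]_(k, n)) (G0 : 'M[F]_(l, n)) (H : 'M[F]_(r, n)) (Gt1 : 'M[F]_(k, n))
  (hG1 : generator_matrix G1 C1) (hG0 : generator_matrix G0 C0)
  (hH : parity_check_matrix H (C1 + C0)%VS)
  (hGt1 : G1 *m Gt1^T = 1%:M) (hGt0 : G0 *m Gt1^T = 0)
  (d0 d1 : nat) (hd0 : is_d0 G0 d0) (hd1 : is_d1 Gt1 H d1)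
  (D : 'rV[F]_k -> 'rV[option F]_n -> 'rV[F]_l)
  (hD : two_step_encoding G1 G0 d0 D)
  (zhat : 'rV[F]_r -> 'rV[F]_n) (hzhat : min_weight_estimate H zhat)
  (eps p : R) (heps : 0 <= eps <= 1) (hp : 0 <= p <= 1)
  (d : measure_display) (Omega : measurableType d) (P : probability Omega R)
  (W : Omega -> 'rV[F]_k) (S : Omega -> 'rV[option F]_n) (Z : Omega -> 'rV[F]_n)
  (hmodel : symmetric_memory_model eps p P W S Z) :
  let t1 := ((d1 - 1) %/ 2)%N in
  let y omega := mem_output (plbc_encode G1 G0 D (W omega) (S omega)) (S omega) (Z omega) in
  let what omega := plbc_decode H Gt1 zhat (y omega) in
  (P [set omega | what omega != W omega] <=
   (\sum_(d0 <= u < n.+1)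
      ('C(n, u)%:R * eps ^+ u * (1 - eps) ^+ (n - u)
       * ((\sum_(d0 <= w < u.+1) (weight_count G0 w)%:R * 'C(n - w, u - w)%:R)
          / 'C(n, u)%:R)
       * \sum_(t1 + d0 - u <= t < (n - u).+1)
           'C(n - u, t)%:R * p ^+ t * (1 - p) ^+ (n - u - t))
    + \sum_(0 <= u < n.+1)
        ('C(n, u)%:R * eps ^+ u * (1 - eps) ^+ (n - u)
         * \sum_(t1 + 1 <= t < (n - u).+1)
             'C(n - u, t)%:R * p ^+ t * (1 - p) ^+ (n - u - t)))%:E)%E.
Proof.
cbv zeta; set E := [set omega | _].
(* The failure event is a preimage under the joint variable of message, defects and errors. *)
have mE : measurable E.
  have := discrete_rv_model hmodel [set x | plbc_decode H Gt1 zhat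
    (mem_output (plbc_encode G1 G0 D x.1 x.2.1) x.2.1 x.2.2) != x.1].
  by [].
pose Y om := (defects (S om), hsupport (Z om)).
have mY : discrete_rv Y.
  exact: (discrete_rv_comp (fun x => (defects x.2.1, hsupport x.2.2))
    (discrete_rv_model hmodel)).
apply: le_trans (probability_le_fibers P (Q := fun x => failure_pattern G0 d0 d1 x.1 x.2)
  mY mE _) _.
  (* The inclusion holds outcome by outcome, so only the law of [Y] remains to be summed. *)
  by move=> om; exact: (failure_patternP hG1 hG0 hH hGt1 hGt0).
have pY x : P (Y @^-1` [set x]) =
    (\prod_(i < n) cell_status_prob eps p (i \in x.1) (i \in x.2))%:E.
  by case: x => U V; exact: (probability_pattern hmodel).
rewrite (eq_bigr _ (fun x _ => pY x)).
by rewrite sumEFin lee_fin; exact: sum_failure_patterns.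
Qed.
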